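(* Consider the cyclically closed $2\times2\times M$ gonihedric model described in the context, with real parameters $J_1,J_2,J_3$ and temperature $T>0$. Let $\lambda_{\max}$ be the largest real root of the characteristic equation of the $4\times4$ matrix $\tau$ and $\mu_{\max}$ the largest real root of the characteristic equation of the $3\times3$ matrix $\tau'$ (both defined in the context). Then the free energy per site $f(T)=-k_BT\lim_{M\to\infty}\frac{1}{4M}\ln Z_M$ equals $-\frac{k_BT}{4}\ln\lambda_{\max}$, the internal energy per site $u=-T^2\partial_T[f/T]$ equals $k_BT^2\partial_T[\frac14\ln\lambda_{\max}]$, the heat capacity per site $C=\partial_Tu$ equals $2k_BT\partial_T[\frac14\ln\lambda_{\max}]+k_BT^2\partial_T^2[\frac14\ln\lambda_{\max}]$, and the non-percolation probability $P_M=Z'_M/Z_M$ satisfies $\lim_{M\to\infty}\frac{\ln P_M}{M}=\ln\frac{\mu_{\max}}{\lambda_{\max}}$.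
   Context: Sites $t_i^m$, $i\in\{0,1,2,3\}$ (indices mod 4), $m\in\{0,\dots,M-1\}$, cyclically closed, spins $\sigma_i^m\in\{-1,1\}$. The cube energy is $$\mathcal H^m=-\sum_{r=0}^3\Big(J_1\big[\tfrac12\sigma_r^m\sigma_{r+1}^m+\tfrac12\sigma_r^{m+1}\sigma_{r+1}^{m+1}+\sigma_r^m\sigma_r^{m+1}\big]+J_2\big[\tfrac14\sigma_r^m\sigma_{r+2}^m+\tfrac14\sigma_r^{m+1}\sigma_{r+2}^{m+1}+\sigma_r^m\sigma_{r+1}^{m+1}+\sigma_r^m\sigma_{r-1}^{m+1}\big]+J_3\big[\tfrac18\textstyle\prod_i\sigma_i^m+\tfrac18\prod_i\sigma_i^{m+1}+\sigma_r^m\sigma_{r+1}^m\sigma_r^{m+1}\sigma_{r+1}^{m+1}\big]\Big),$$ $\mathcal H=\sum_m\mathcal H^m$, $Z_M=\sum_\sigma e^{-\mathcal H/(k_BT)}$ over all $\sigma\in\{-1,1\}^{4M}$; $Z'_M$ is the same sum restricted to configurations with no $m$ and $r$ such that $\sigma_r^m=\sigma_{r+1}^m=-1$. Transfer matrices: index a layer state $(s_0,\dots,s_3)$ by $k=1+\sum_i2^i(1-s_i)/2\in\{1,\dots,16\}$; $\theta_{k,l}=\exp(-\mathcal H^m/(k_BT))$ with layer $m$ in state $k$ and layer $m+1$ in state $l$. $\tau_{i,j}=\sum_{l\in G_j}\theta_{r_i,l}$ with $(r_i)=(1,2,4,6)$, $G_1=\{1,16\}$, $G_2=\{2,3,5,8,9,12,14,15\}$,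 $G_3=\{4,7,10,13\}$, $G_4=\{6,11\}$; $\tau'_{i,j}=\sum_{l\in G'_j}\theta_{r'_i,l}$ with $(r'_i)=(1,2,6)$, $G'_1=\{1\}$, $G'_2=\{2,3,5,9\}$, $G'_3=\{6,11\}$. *)

(* Defs.v *)
From HB Require Import structures.
From mathcomp Require Import all_boot all_order all_algebra.
From mathcomp Require Import all_classical all_reals all_analysis.
Set Implicit Arguments. Unset Strict Implicit. Unset Printing Implicit Defensive.
Import Order.TTheory GRing.Theory Num.Theory.
Import numFieldNormedType.Exports.
Local Open Scope classical_set_scope.
Local Open Scope ring_scope.

Section Gonihedric.
Variable R : realType.

Definition shift4 (r : 'I_4) (k : nat) : 'I_4 := inord ((r + k) %% 4)%N.

(* energy H^m of a cube, given the spins a = sigma^m and b = sigma^{m+1} *)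
Definition cube_energy (J1 J2 J3 : R) (a b : 'I_4 -> R) : R :=
  - \sum_(r < 4)
      ( J1 * (a r * a (shift4 r 1) / 2 + b r * b (shift4 r 1) / 2 + a r * b r)
      + J2 * (a r * a (shift4 r 2) / 4 + b r * b (shift4 r 2) / 4
              + a r * b (shift4 r 1) + a r * b (shift4 r 3))
      + J3 * ((\prod_(i < 4) a i) / 8 + (\prod_(i < 4) b i) / 8
              + a r * a (shift4 r 1) * b r * b (shift4 r 1)) ).

Definition config (M : nat) := {ffun 'I_M -> {ffun 'I_4 -> bool}}.
Definition spin (b : bool) : R := if b then 1 else -1.

Definition next_layer {M : nat} (m : 'I_M) : 'I_M :=
  Ordinal (ltn_pmod m.+1 (leq_ltn_trans (leq0n m) (ltn_ord m))).

Definition energy (J1 J2 J3 : R) (M : nat) (s : config M) : R :=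
  \sum_(m < M) cube_energy J1 J2 J3 (fun i => spin (s m i))
                                    (fun i => spin (s (next_layer m) i)).

Definition nonperc (M : nat) (s : config M) : bool :=
  [forall m : 'I_M, forall r : 'I_4, ~~ (~~ s m r && ~~ s m (shift4 r 1))].

Definition Z (kB J1 J2 J3 : R) (M : nat) (T : R) : R :=
  \sum_(s : config M) expR (- energy J1 J2 J3 s / (kB * T)).

Definition Z' (kB J1 J2 J3 : R) (M : nat) (T : R) : R :=
  \sum_(s : config M | nonperc s) expR (- energy J1 J2 J3 s / (kB * T)).

(* layer state k in {1..16}: k = 1 + sum_i 2^i (1 - s_i)/2, i.e. s_i = -1 iff
   bit i of k-1 is set *)
Definition state (k : nat) : 'I_4 -> R :=
  fun i => if odd ((k.-1) %/ 2 ^ i)%N then -1 else 1.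

Definition theta (kB J1 J2 J3 T : R) (k l : nat) : R :=
  expR (- cube_energy J1 J2 J3 (state k) (state l) / (kB * T)).

Definition reps : seq nat := [:: 1; 2; 4; 6]%N.
Definition groups : seq (seq nat) :=
  [:: [:: 1; 16]; [:: 2; 3; 5; 8; 9; 12; 14; 15]; [:: 4; 7; 10; 13]; [:: 6; 11]]%N.
Definition reps' : seq nat := [:: 1; 2; 6]%N.
Definition groups' : seq (seq nat) := [:: [:: 1]; [:: 2; 3; 5; 9]; [:: 6; 11]]%N.

Definition tau (kB J1 J2 J3 T : R) : 'M[R]_4 :=
  \matrix_(i < 4, j < 4)
    \sum_(l <- nth [::] groups j) theta kB J1 J2 J3 T (nth 0%N reps i) l.

Definition tau' (kB J1 J2 J3 T : R) : 'M[R]_3 :=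
  \matrix_(i < 3, j < 3)
    \sum_(l <- nth [::] groups' j) theta kB J1 J2 J3 T (nth 0%N reps' i) l.

Definition largest_real_root (p : {poly R}) (x : R) : Prop :=
  root p x /\ forall y, root p y -> y <= x.

Definition free_energy (kB J1 J2 J3 : R) (T : R) : R :=
  - kB * T * limn (fun M : nat => ln (Z kB J1 J2 J3 M T) / (4 * M%:R) : R).

Definition internal_energy (kB J1 J2 J3 : R) (T : R) : R :=
  - T ^+ 2 * derive1 (fun t => free_energy kB J1 J2 J3 t / t) T.

Definition heat_capacity (kB J1 J2 J3 : R) (T : R) : R :=
  derive1 (internal_energy kB J1 J2 J3) T.

End Gonihedric.

(* Main.v *)
(* Each partition function is a trace of powers of a positive transfer kernel
   on the admissible layer states.  Rotating a layer or flipping all spins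
   leaves the cube energy invariant, so the kernel lumps to tau (resp. tau')
   and a positive right eigenvector of the lumped matrix lifts to one of the
   kernel; comparing with it gives c lam^M <= Z_M <= C lam^M, hence the limits.
   By Perron's theorem the largest real root lam of a positive matrix has
   positive left and right eigenvectors u and v, which are a row and a column of
   the adjugate of lam - tau.  The identity
     lam(t) - lam(s) = u(s) (tau(t) - tau(s)) v(t) / (u(s) v(t))
   first gives continuity of lam, then lam' = u tau' v / (u v), and the right
   hand side is again differentiable because u and v are polynomials in lam and
   the entries of tau. *)
Require Import Defs.
From HB Require Import structures.
From mathcomp Require Import all_boot all_order all_algebra.
From mathcomp Require Import all_classical all_reals all_analysis.
From mathcomp Require Import ring.
Import Order.TTheory GRing.Theory Num.Theory.
Import numFieldNormedType.Exports.
Local Open Scope classical_set_scope.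
Local Open Scope ring_scope.
Set Implicit Arguments.
Unset Strict Implicit.
Unset Printing Implicit Defensive.

(** * Perron's theorem for positive matrices *)

Definition posmx (R : realType) (m n : nat) (A : 'M[R]_(m, n)) :=
  forall i j, 0 < A i j.

Lemma exists_gt0_lower_bound (R : realType) (I : finType) (f : I -> R) :
  (forall i, 0 < f i) -> exists2 c, 0 < c & forall i, c <= f i.
Proof.
move=> f0; exists (\big[Order.min/1]_i f i).
  by apply/bigmin_gtP; split=> // i _.
by move=> i; by apply: bigmin_le_cond.
Qed.

Lemma continuous_sum (R : realType) (T : topologicalType) (I : finType)
    (f : I -> T -> R) (x : T) :
  (forall i, {for x, continuous (f i)}) ->
  {for x, continuous (fun y => \sum_i f i y)}.
Proof. by move=> fx; apply: cvg_big => [|i _]; [exact: add_continuous|exact: fx]. Qed.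

Lemma pos_dot_gt0 (R : realType) (I : finType) (a b : I -> R) :
  (forall i, 0 <= a i) -> (exists i, a i != 0) -> (forall i, 0 < b i) ->
  0 < \sum_i a i * b i.
Proof.
move=> a0 [i ai] b0; rewrite (bigD1 i)//=; apply: ltr_pwDl.
  by rewrite mulr_gt0// lt0r ai a0.
by apply: sumr_ge0 => j _; rewrite mulr_ge0// ltW.
Qed.

Lemma rV_neq0P (R : realType) n (v : 'rV[R]_n) :
  v != 0 -> exists i, v 0 i != 0.
Proof.
move=> v0; apply/existsP; apply: contraNT v0 => /existsPn v0.
by apply/eqP/rowP => i; rewrite mxE; apply/eqP; rewrite -[_ == _]negbK.
Qed.

Lemma mulmx_posmx (R : realType) n p (v : 'rV[R]_n) (A : 'M[R]_(n, p)) :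
  (forall i, 0 <= v 0 i) -> v != 0 -> posmx A -> posmx (v *m A).
Proof.
move=> v0 vn0 A0 i j; rewrite mxE ord1; apply: pos_dot_gt0 => //.
exact: rV_neq0P.
Qed.

(** The constraints are closed conditions inside the compact product of [0, B] with a unit cube. The
    set consists of the pairs (x, v) among which [perron_exists] maximises x. *)
Lemma simplex_posmx_compact (R : realType) n (A : 'M[R]_n.+1) (B : R) :
  compact [set p : R * 'rV[R]_n.+1 |
    [/\ 0 <= p.1 <= B, forall i, 0 <= p.2 0 i <= 1, \sum_i p.2 0 i = 1
      & forall j, p.1 * p.2 0 j <= (p.2 *m A) 0 j]].
Proof.
set C := (X in compact X).
have snd_coord (p : R * 'rV[R]_n.+1) i :
    {for p, continuous (fun p : R * 'rV[R]_n.+1 => p.2 0 i)}.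
  apply: (@continuous_comp _ _ _ snd (fun v : 'rV[R]_n.+1 => v 0 i)).
    exact: cvg_snd.
  exact: coord_continuous.
pose D := `[0, B]%classic `*` [set v : 'rV[R]_n.+1 | forall i, `[0, 1]%classic (v ord0 i)].
have cD : compact D.
  apply: compact_setX; first exact: segment_compact.
  by apply: (@rV_compact R n.+1 (fun=> `[0, 1]%classic)) => i; exact: segment_compact.
pose E := [set p : R * 'rV[R]_n.+1 | \sum_i p.2 0 i = 1] `&`
  \bigcap_(j in setT) [set p : R * 'rV[R]_n.+1 | 0 <= (p.2 *m A) 0 j - p.1 * p.2 0 j].
have cE : closed E.
  apply: (@closedI (R * 'rV[R]_n.+1)%type).
    apply: (@preimage_closed _ _ (fun p : R * 'rV[R]_n.+1 => \sum_i p.2 0 i) [set x | x = 1]).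
      by move=> p _; apply: continuous_sum => i; exact: snd_coord.
    exact: closed_eq.
  apply: (@closed_bigI (R * 'rV[R]_n.+1)%type) => j _.
  apply: (@preimage_closed _ _ (fun p : R * 'rV[R]_n.+1 => (p.2 *m A) 0 j - p.1 * p.2 0 j) [set x | 0 <= x]).
    move=> p _.
    have -> : (fun p : R * 'rV[R]_n.+1 => (p.2 *m A) 0 j - p.1 * p.2 0 j) =
              (fun p : R * 'rV[R]_n.+1 => \sum_i p.2 0 i * A i j - p.1 * p.2 0 j).
      by apply/funext => q; rewrite mxE.
    apply: cvgB.
      apply: continuous_sum => i; apply: cvgM; first exact: snd_coord.
      exact: cvg_cst.
    by apply: cvgM; [exact: cvg_fst|exact: snd_coord].
  exact: closed_ge.
suff -> : C = D `&` E.
  exact: (compact_closedI cD cE).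
apply/seteqP; split => [p [p1 p2 p3 p4]|p [[/= p1 p2] [/= p3 p4]]].
  split.
    by split; [rewrite /= in_itv|move=> i; rewrite /= in_itv; exact: p2].
  by split => //= j _ /=; rewrite subr_ge0.
split; [by move: p1; rewrite in_itv| |exact: p3|].
  by move=> i; move: (p2 i); rewrite /= in_itv.
by move=> j; rewrite -subr_ge0; apply: (p4 j).
Qed.

(* Among the pairs (x, v) with v in the simplex and x v <= v A, one with
   maximal x satisfies x v = v A: otherwise v A, normalised, admits a larger x. *)
Lemma perron_exists (R : realType) n (A : 'M[R]_n.+1) : posmx A ->
  exists r (v : 'rV[R]_n.+1), [/\ 0 < r, posmx v & v *m A = r *: v].
Proof.
move=> A0.
(* Summing x v_j <= (v A)_j over j, with v in the simplex, shows that [B] bounds every competing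
   x. *)
pose B := \sum_i \sum_j A i j.
pose C := [set p : R * 'rV[R]_n.+1 |
    [/\ 0 <= p.1 <= B, forall i, 0 <= p.2 0 i <= 1, \sum_i p.2 0 i = 1
      & forall j, p.1 * p.2 0 j <= (p.2 *m A) 0 j]].
have normC x (v : 'rV[R]_n.+1) : 0 <= x -> (forall i, 0 <= v 0 i) -> v != 0 ->
    (forall j, x * v 0 j <= (v *m A) 0 j) ->
    C (x, (\sum_i v 0 i)^-1 *: v).
  move=> x0 v0 vn0 xv.
  have s0 : 0 < \sum_i v 0 i.
    under eq_bigr do rewrite -[v _ _]mulr1.
    by apply: pos_dot_gt0 => //; exact: rV_neq0P.
  have v1 i : v 0 i <= \sum_i v 0 i.
    by rewrite (bigD1 i)//= lerDl sumr_ge0.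
  split => /=.
  - rewrite x0/= -(ler_pM2r s0).
    rewrite mulr_sumr; apply: (@le_trans _ _ (\sum_j (v *m A) 0 j)).
      exact: ler_sum.
    under eq_bigr do rewrite mxE.
    rewrite exchange_big/= /B mulr_suml; apply: ler_sum => i _.
    rewrite mulr_suml; apply: ler_sum => j _.
    by rewrite mulrC ler_wpM2l// ltW.
  - move=> i; rewrite mxE mulr_ge0 ?invr_ge0 ?(ltW s0)//=.
    by rewrite mulrC ler_pdivrMr// mul1r.
  - by under eq_bigr do rewrite mxE; rewrite -mulr_sumr mulVf// gt_eqF.
  - move=> j; rewrite -scalemxAl !mxE mulrCA; apply: ler_wpM2l.
      by rewrite invr_ge0 ltW.
    by move: (xv j); rewrite mxE.
have Cn0 : C !=set0.
  exists (0, (\sum_i (const_mx 1 : 'rV[R]_n.+1) 0 i)^-1 *: const_mx 1).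
  have c1 : (const_mx 1 : 'rV[R]_n.+1) != 0.
    by apply/eqP => /rowP/(_ ord0); rewrite !mxE => /eqP; rewrite oner_eq0.
  apply: normC => // [i|j]; first by rewrite mxE.
  rewrite mul0r mxE.
  by apply: sumr_ge0 => i _; rewrite mxE mul1r ltW.
have [[r v] /set_mem[/= r0 v0 v1 rv] rmax] :
    exists2 c, c \in C & forall t, t \in C -> t.1 <= c.1.
  apply: compact_EVT_max => //; first exact: simplex_posmx_compact.
  by apply: continuous_subspaceT => p; exact: cvg_fst.
have vn0 : v != 0.
  apply/eqP => v0'; move: v1; rewrite v0' big1 ?oner_eq0 => [/eqP|i _].
    by rewrite eq_sym oner_eq0.
  by rewrite mxE.
have vge i : 0 <= v 0 i by case/andP: (v0 i).
have vA := mulmx_posmx vge vn0 A0.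
have eqrv : v *m A = r *: v.
  apply: contrapT => ne.
  pose d := v *m A - r *: v.
  have dn0 : d != 0 by rewrite subr_eq0; apply/eqP.
  have d0 i : 0 <= d 0 i.
    by rewrite /d mxE [X in _ + X]mxE [X in - X]mxE subr_ge0 rv.
  have dA := mulmx_posmx d0 dn0 A0.
  (* As d A is positive, c (v A) <= d A for some c > 0, that is, (r + c) (v A) <= (v A) A. *)
  have [c c0 cle] := @exists_gt0_lower_bound R _
    (fun j => (d *m A) 0 j / (v *m A) 0 j)
    (fun j => divr_gt0 (dA 0 j) (vA 0 j)).
  have : C (r + c, (\sum_i (v *m A) 0 i)^-1 *: (v *m A)).
    apply: normC.
    - by case/andP: r0 => r0 _; rewrite addr_ge0// ltW.
    - by move=> i; rewrite ltW.
    - by apply/eqP => /rowP/(_ ord0) h; have := vA 0 ord0; rewrite h mxE ltxx.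
    - move=> j; have := cle j; rewrite ler_pdivlMr//.
      rewrite {1}/d mulmxBl -scalemxAl [X in _ <= X]mxE [X in _ <= _ + X]mxE.
      by rewrite [X in _ <= _ - X]mxE lerBrDl -mulrDl.
  by move=> /mem_set/rmax/=; rewrite gerDl leNgt c0.
have vpos : posmx v.
  move=> i j; rewrite ord1 lt_neqAle vge andbT eq_sym; apply/eqP => vj.
  by have := vA 0 j; rewrite eqrv mxE vj mulr0 ltxx.
exists r, v; split => //.
by have := vA 0 ord0; rewrite eqrv mxE pmulr_lgt0.
Qed.

Lemma posmx_dot_gt0 (R : realType) n (X : 'rV[R]_n) (w : 'cV[R]_n) :
  (forall i, 0 <= X 0 i) -> X != 0 -> posmx w -> 0 < (X *m w) 0 0.
Proof. by move=> X0 Xn0 w0; exact: mulmx_posmx. Qed.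

Lemma posmx_neq0 (R : realType) n (v : 'rV[R]_n.+1) : posmx v -> v != 0.
Proof.
by move=> v0; apply/eqP => v00; have := v0 0 0; rewrite v00 mxE ltxx.
Qed.

(** The right vector comes from the transpose, with its own eigenvalue r'. Evaluating v A w in two
    ways gives r = r', since v w > 0. *)
Lemma perron_pair (R : realType) n (A : 'M[R]_n.+1) : posmx A ->
  exists r (v : 'rV[R]_n.+1) (w : 'cV[R]_n.+1),
    [/\ 0 < r, posmx v, posmx w, v *m A = r *: v & A *m w = r *: w].
Proof.
move=> A0; have [r [v [r0 v0 vA]]] := perron_exists A0.
have At0 : posmx A^T by move=> i j; rewrite mxE.
have [r' [w [r'0 w0 wA]]] := perron_exists At0.
have wt0 : posmx w^T by move=> i j; rewrite mxE.
have Aw : A *m w^T = r' *: w^T by rewrite -[A]trmxK -trmx_mul wA linearZ.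
exists r, v, w^T; split=> //; rewrite Aw.
suff -> : r = r' by [].
have vw : 0 < (v *m w^T) 0 0.
  by apply: posmx_dot_gt0 => //; [move=> i; exact: ltW|exact: posmx_neq0].
apply/(mulIf (lt0r_neq0 vw)); transitivity ((v *m A *m w^T) 0 0).
  by rewrite vA -scalemxAl [RHS]mxE.
by rewrite -mulmxA Aw -scalemxAr mxE.
Qed.

(** Pairing the nonnegative vector X A - l X with the positive [w] gives 0, so it vanishes. A zero
    entry of X would then be a zero entry of the positive vector X A. *)
Lemma superinvariant_eq (R : realType) n (A : 'M[R]_n.+1) (l : R)
    (w : 'cV[R]_n.+1) (X : 'rV[R]_n.+1) :
  posmx A -> posmx w -> A *m w = l *: w ->
  (forall i, 0 <= X 0 i) -> X != 0 ->
  (forall j, l * X 0 j <= (X *m A) 0 j) -> X *m A = l *: X /\ posmx X.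
Proof.
move=> A0 w0 Aw X0 Xn0 lX.
have XA : X *m A = l *: X.
  apply/eqP; rewrite -subr_eq0; apply/negP => /negP Yn0.
  have : 0 < ((X *m A - l *: X) *m w) 0 0.
    apply: posmx_dot_gt0 => // j.
    by rewrite mxE [X in _ + X]mxE [X in - X]mxE subr_ge0.
  by rewrite mulmxBl -mulmxA Aw -scalemxAl -scalemxAr subrr mxE ltxx.
split=> // i j; rewrite ord1 lt_neqAle X0 andbT eq_sym; apply/eqP => Xj.
by have := mulmx_posmx X0 Xn0 A0 0 j; rewrite XA mxE Xj mulr0 ltxx.
Qed.

Lemma normr_mulmx_le (R : realType) n p (X : 'rV[R]_n) (A : 'M[R]_(n, p)) j :
  posmx A -> `|(X *m A) 0 j| <= (map_mx Num.norm X *m A) 0 j.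
Proof.
move=> A0; rewrite !mxE; apply: le_trans (ler_norm_sum _ _ _) _.
by apply: ler_sum => i _; rewrite normrM mxE (gtr0_norm (A0 _ _)).
Qed.

Lemma map_norm_neq0 (R : realType) n (X : 'rV[R]_n) :
  X != 0 -> map_mx Num.norm X != 0.
Proof.
apply: contra => /eqP/rowP X0; apply/eqP/rowP => i.
by have := X0 i; rewrite !mxE => /eqP; rewrite normr_eq0 => /eqP.
Qed.

(** The eigenvalue r of [perron_pair] is a root, so r <= l. Conversely, an eigenvector X for l
    satisfies |l| |X| <= |X| A, and pairing with [w] gives |l| <= r. *)
Lemma largest_real_root_perron (R : realType) n (A : 'M[R]_n.+1) (l : R) :
  posmx A -> largest_real_root (char_poly A) l ->
  exists (v : 'rV[R]_n.+1) (w : 'cV[R]_n.+1),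
    [/\ 0 < l, posmx v, posmx w, v *m A = l *: v & A *m w = l *: w].
Proof.
move=> A0 [rl lmax]; have [r [v [w [r0 v0 w0 vA Aw]]]] := perron_pair A0.
suff -> : l = r by exists v, w.
apply/eqP; rewrite eq_le; apply/andP; split; last first.
  apply: lmax; rewrite -eigenvalue_root_char; apply/eigenvalueP.
  by exists v => //; exact: posmx_neq0.
move: rl; rewrite -eigenvalue_root_char => /eigenvalueP[X XA Xn0].
apply: le_trans (ler_norm _) _.
have Xw : 0 < (map_mx Num.norm X *m w) 0 0.
  by apply: posmx_dot_gt0 => //; [move=> i; rewrite mxE|exact: map_norm_neq0].
rewrite -(ler_pM2r Xw).
have <- : (map_mx Num.norm X *m A *m w) 0 0 = r * (map_mx Num.norm X *m w) 0 0.
  by rewrite -mulmxA Aw -scalemxAr mxE.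
rewrite [in X in X <= _]mxE mulr_sumr [X in _ <= X]mxE; apply: ler_sum => i _.
rewrite mulrA ler_pM2r// mxE -normrM.
by apply: le_trans (normr_mulmx_le _ _ A0); rewrite XA mxE.
Qed.

(** The adjugate yields Perron vectors only up to sign; a constant strict sign is what keeps their
    pairings nonzero. *)
Definition definite (R : realType) m n (X : 'M[R]_(m, n)) :=
  posmx X \/ posmx (- X).

Lemma definite_mul_neq0 (R : realType) n (u : 'rV[R]_n.+1)
    (v : 'cV[R]_n.+1) : definite u -> definite v -> (u *m v) 0 0 != 0.
Proof.
have pp (x : 'rV[R]_n.+1) (y : 'cV[R]_n.+1) :
    posmx x -> posmx y -> 0 < (x *m y) 0 0.
  by move=> x0 y0; apply: posmx_dot_gt0 => //; [move=> i; exact: ltW|exact: posmx_neq0].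
have N1 (x : 'M[R]_1) : (- x) 0 0 = - x 0 0 by rewrite mxE.
case=> u0 [] v0; have := pp _ _ u0 v0; rewrite ?mulNmx ?mulmxN ?opprK ?N1 ?oppr_gt0.
- exact: lt0r_neq0.
- exact: ltr0_neq0.
- exact: ltr0_neq0.
- exact: lt0r_neq0.
Qed.

(* If W is not positive, then |W| - W is a nonnegative eigenvector, hence
   positive, and W is negative. *)
Lemma eigenvector_definite (R : realType) n (A : 'M[R]_n.+1) (l : R)
    (w : 'cV[R]_n.+1) (W : 'rV[R]_n.+1) :
  posmx A -> posmx w -> 0 < l -> A *m w = l *: w -> W != 0 ->
  W *m A = l *: W -> definite W.
Proof.
move=> A0 w0 l0 Aw Wn0 WA.
have [absA abs0] :
    map_mx Num.norm W *m A = l *: map_mx Num.norm W /\ posmx (map_mx Num.norm W).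
  apply: (superinvariant_eq A0 w0 Aw).
  - by move=> i; rewrite mxE.
  - exact: map_norm_neq0.
  - move=> j; apply: le_trans (normr_mulmx_le _ _ A0).
    by rewrite WA !mxE normrM gtr0_norm.
have [X0|Xn0] := eqVneq (map_mx Num.norm W - W) 0.
  by left; rewrite -(subr0_eq X0); exact: abs0.
right; have [_ X0] : (map_mx Num.norm W - W) *m A = l *: (map_mx Num.norm W - W)
    /\ posmx (map_mx Num.norm W - W).
  apply: (superinvariant_eq A0 w0 Aw) => //.
    by move=> i; rewrite !mxE subr_ge0 ler_norm.
  by move=> j; rewrite mulmxBl absA WA -scalerBr [X in _ <= X]mxE.
move=> i j; have := X0 i j; rewrite !mxE subr_gt0 oppr_gt0.
by case: (ltP (W i j) 0) => // /ger0_norm ->; rewrite ltxx.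
Qed.

(* A null vector of the principal minor, padded by a zero, would be a
   nonnegative superinvariant vector with a vanishing entry. *)
Lemma perron_adj00_neq0 (R : realType) n (A : 'M[R]_n.+1) (l : R)
    (w : 'cV[R]_n.+1) :
  posmx A -> posmx w -> 0 < l -> A *m w = l *: w ->
  \adj (l%:M - A) 0 0 != 0.
Proof.
move=> A0 w0 l0 Aw; rewrite mxE /cofactor mulf_neq0 ?signr_eq0//.
apply/negP => /det0P[x xn0 xM].
pose W := \row_j (if unlift ord0 j is Some k then x 0 k else 0) : 'rV[R]_n.+1.
have W0 : W 0 0 = 0 by rewrite mxE unlift_none.
have WS k : W 0 (lift ord0 k) = x 0 k by rewrite mxE liftK.
have Wn0 : W != 0.
  apply: contra xn0 => /eqP/rowP W00; apply/eqP/rowP => k.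
  by have := W00 (lift ord0 k); rewrite WS !mxE.
have WA k : (W *m A) 0 (lift ord0 k) = l * W 0 (lift ord0 k).
  move/rowP/(_ k): xM; rewrite [X in _ = X]mxE => xMk.
  have : (W *m (l%:M - A)) 0 (lift ord0 k) = 0.
    rewrite mxE big_ord_recl W0 mul0r add0r.
    by rewrite -[RHS]xMk [RHS]mxE; apply: eq_bigr => i _; rewrite WS !mxE.
  rewrite mulmxBr mul_mx_scalar mxE [X in X + _]mxE [X in _ + X]mxE => /eqP.
  by rewrite subr_eq0 => /eqP.
have [_ abs0] : map_mx Num.norm W *m A = l *: map_mx Num.norm W
    /\ posmx (map_mx Num.norm W).
  apply: (superinvariant_eq A0 w0 Aw).
  - by move=> i; rewrite mxE.
  - exact: map_norm_neq0.
  (* Column 0 of W A is not controlled, but since W_0 = 0 the bound there only reads 0 <= |(W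
     A)_0|. *)
  - move=> j; apply: le_trans (normr_mulmx_le _ _ A0).
    case: (unliftP ord0 j) => [k|] ->; last by rewrite mxE W0 normr0 mulr0.
    by rewrite WA normrM gtr0_norm// mxE.
by have := abs0 0 0; rewrite mxE W0 normr0 ltxx.
Qed.

(** Since l - A is singular, its products with its adjugate vanish, so rows and columns of the
    adjugate solve the eigenvector equations. The nonzero corner entry makes row 0 and column 0
    nonzero, hence of one sign; the column is treated through the transpose. *)
Lemma perron_adj (R : realType) n (A : 'M[R]_n.+1) (l : R)
    (u := row 0 (\adj (l%:M - A))) (v := col 0 (\adj (l%:M - A))) :
  posmx A -> largest_real_root (char_poly A) l ->
  [/\ definite u, definite v, u *m A = l *: u & A *m v = l *: v].
Proof.
move=> A0 lA; have [x [y [l0 x0 y0 xA Ay]]] := largest_real_root_perron A0 lA.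
have d0 : \det (l%:M - A) = 0.
  apply/eqP/det0P; exists x; first exact: posmx_neq0.
  by rewrite mulmxBr mul_mx_scalar xA subrr.
have adj0 := perron_adj00_neq0 A0 y0 l0 Ay.
have uA : u *m A = l *: u.
  apply/eqP; rewrite eq_sym -subr_eq0 -mul_mx_scalar -mulmxBr.
  by rewrite /u -row_mul mul_adj_mx d0 raddf0 row0.
have Av : A *m v = l *: v.
  apply/eqP; rewrite eq_sym -subr_eq0 -mul_scalar_mx -mulmxBl.
  by rewrite /v colE mulmxA mul_mx_adj d0 mul_scalar_mx scale0r.
split=> //.
  apply: (eigenvector_definite A0 y0 l0 Ay) => //.
  by apply: contra adj0 => /eqP/rowP/(_ 0); rewrite !mxE => ->.
have At0 : posmx A^T by move=> i j; rewrite mxE.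
have xt0 : posmx x^T by move=> i j; rewrite mxE.
have : definite v^T.
  apply: (eigenvector_definite At0 xt0 l0).
  - by rewrite -trmx_mul xA linearZ.
  - by apply: contra adj0 => /eqP/rowP/(_ 0); rewrite !mxE => ->.
  - by rewrite -trmx_mul Av linearZ.
by case=> v0; [left|right] => i j; have := v0 j i; rewrite !mxE.
Qed.

(** * Smooth dependence of the Perron root *)

(** With v the left Perron vector of A and w the right one of B, (m - l) v w = v (B - A) w. The sum
    of the entries of w cancels from the bounds on both sides, leaving a constant that depends on A
    alone. *)
Lemma perron_root_lipschitz (R : realType) n (A : 'M[R]_n.+1) (l : R) :
  posmx A -> largest_real_root (char_poly A) l ->
  exists K, forall (B : 'M[R]_n.+1) m,
    posmx B -> largest_real_root (char_poly B) m ->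
    `|m - l| <= K * \sum_i \sum_j `|B i j - A i j|.
Proof.
move=> A0 lA; have [v [_ [_ v0 _ vA _]]] := largest_real_root_perron A0 lA.
have [c c0 cv] := @exists_gt0_lower_bound R _ (v 0) (v0 0).
pose V := \sum_i v 0 i; exists (V / c) => B m B0 mB.
have [_ [w [_ _ w0 _ Bw]]] := largest_real_root_perron B0 mB.
set S := \sum_i _; pose W := \sum_j w j 0.
have W0 : 0 < W.
  by rewrite /W big_ord_recl ltr_pwDl// sumr_ge0// => i _; rewrite ltW.
have S0 : 0 <= S by do 2! apply: sumr_ge0 => ? _.
rewrite mulrAC ler_pdivlMr// -(ler_pM2r W0).
have eqvw : (m - l) * (v *m w) 0 0 = (v *m (B - A) *m w) 0 0.
  rewrite mulmxBr mulmxBl -mulmxA Bw vA -scalemxAr -scalemxAl.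
  by rewrite [RHS]mxE [X in _ = _ + X]mxE [X in _ = X - _]mxE [X in _ - X]mxE mulrBl.
have vw : c * W <= (v *m w) 0 0.
  by rewrite mxE /W mulr_sumr; apply: ler_sum => i _; rewrite ler_pM2r.
apply: (@le_trans _ _ `|(m - l) * (v *m w) 0 0|).
  rewrite normrM -mulrA ler_wpM2l//; exact: le_trans vw (ler_norm _).
rewrite eqvw mxE mulr_sumr; apply: le_trans (ler_norm_sum _ _ _) _.
apply: ler_sum => j _; rewrite normrM (gtr0_norm (w0 _ _)) ler_pM2r//.
rewrite mxE; apply: le_trans (ler_norm_sum _ _ _) _.
rewrite /V mulr_suml; apply: ler_sum => i _.
rewrite normrM (gtr0_norm (v0 _ _)) ler_pM2l//.
rewrite /S (bigD1 i)//= (bigD1 j)//= !mxE -addrA lerDl addr_ge0// ?sumr_ge0//.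
by move=> k _; exact: sumr_ge0.
Qed.

(** As a vanishes at s, the difference quotient of a b is that of a times b(h + s), so continuity of
    b suffices. Here b will involve an eigenvector not yet known to be differentiable. *)
Lemma is_derive_mul_continuous (R : realType) (a b : R -> R) (s da : R) :
  is_derive s 1 a da -> a s = 0 -> {for s, continuous b} ->
  is_derive s 1 (fun t => a t * b t) (da * b s).
Proof.
move=> [da_ex <-] as0 bs.
have H : h^-1 *: (((fun t => a t * b t) \o shift s) (h *: (1 : R)) - a s * b s)
    @[h --> 0^'] --> 'D_1 a s * b s.
  have -> : (fun h : R => h^-1 *: (((fun t => a t * b t) \o shift s) (h *: (1 : R)) - a s * b s)) =
      (fun h => (h^-1 *: ((a \o shift s) (h *: (1 : R)) - a s)) * b (h + s)).
    by apply/funext => h /=; rewrite as0 mul0r !subr0 scalerAl /= [h *: _]mulr1.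
  apply: cvgM; first exact: da_ex.
  apply: (@cvg_comp _ _ _ (fun h => h + s) b _ (nbhs s)) => //.
  apply: cvg_within_filter.
  have : h + s @[h --> 0] --> 0 + s by apply: cvgD; [exact: cvg_id|exact: cvg_cst].
  by rewrite add0r.
apply: DeriveDef; first by apply/cvg_ex; exists ('D_1 a s * b s).
exact: (cvg_lim _ H).
Qed.

(** * Sums, products, determinants and adjugates as functions of a parameter *)

Lemma derivable_fsum (R : realType) (I : Type) (r : seq I) (P : pred I)
    (f : I -> R -> R) (s : R) :
  (forall i, P i -> derivable (f i) s 1) ->
  derivable (fun t => \sum_(i <- r | P i) f i t) s 1.
Proof.
move=> df; elim: r => [|i r IH].
  under eq_fun do rewrite big_nil.
  exact: derivable_cst.
under eq_fun do rewrite big_cons.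
by case: ifP => [Pi|_]; [exact: derivableD (df _ Pi) IH|exact: IH].
Qed.

Lemma derivable_fprod (R : realType) (I : Type) (r : seq I) (P : pred I)
    (f : I -> R -> R) (s : R) :
  (forall i, P i -> derivable (f i) s 1) ->
  derivable (fun t => \prod_(i <- r | P i) f i t) s 1.
Proof.
move=> df; elim: r => [|i r IH].
  under eq_fun do rewrite big_nil.
  exact: derivable_cst.
under eq_fun do rewrite big_cons.
by case: ifP => [Pi|_]; [exact: derivableM (df _ Pi) IH|exact: IH].
Qed.

Lemma continuous_prod (R : realType) (T : topologicalType) (I : finType)
    (f : I -> T -> R) (x : T) :
  (forall i, {for x, continuous (f i)}) ->
  {for x, continuous (fun y => \prod_i f i y)}.
Proof. by move=> fx; apply: cvg_big => [|i _]; [exact: mul_continuous|exact: fx]. Qed.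

Lemma derivable_det (R : realType) n (A : R -> 'M[R]_n) (s : R) :
  (forall i j, derivable (fun t => A t i j) s 1) ->
  derivable (fun t => \det (A t)) s 1.
Proof.
move=> dA; apply: derivable_fsum => p _.
by apply: derivableM; [exact: derivable_cst|apply: derivable_fprod => i _].
Qed.

Lemma continuous_det (R : realType) n (A : R -> 'M[R]_n) (s : R) :
  (forall i j, {for s, continuous (fun t => A t i j)}) ->
  {for s, continuous (fun t => \det (A t))}.
Proof.
move=> cA; apply: continuous_sum => p.
by apply: cvgM; [exact: cvg_cst|apply: continuous_prod => i].
Qed.

Lemma derivable_adj (R : realType) n (A : R -> 'M[R]_n) (s : R) i j :
  (forall i j, derivable (fun t => A t i j) s 1) ->
  derivable (fun t => (\adj (A t)) i j) s 1.
Proof.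
move=> dA; under eq_fun do rewrite mxE.
apply: derivableM; first exact: derivable_cst.
apply: derivable_det => k m.
have -> : (fun t => (row' j (col' i (A t))) k m) = (fun t => A t (lift j k) (lift i m)).
  by apply/funext => t; rewrite !mxE.
exact: dA.
Qed.

Lemma continuous_adj (R : realType) n (A : R -> 'M[R]_n) (s : R) i j :
  (forall i j, {for s, continuous (fun t => A t i j)}) ->
  {for s, continuous (fun t => (\adj (A t)) i j)}.
Proof.
move=> cA.
have -> : (fun t => (\adj (A t)) i j) = (fun t => cofactor (A t) j i).
  by apply/funext => t; rewrite mxE.
apply: cvgM; first exact: cvg_cst.
apply: continuous_det => k m.
have -> : (fun t => (row' j (col' i (A t))) k m) = (fun t => A t (lift j k) (lift i m)).
  by apply/funext => t; rewrite !mxE.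
exact: cA.
Qed.

Lemma derivable_continuous (R : realType) (f : R -> R) (s : R) :
  derivable f s 1 -> {for s, continuous f}.
Proof. by move=> /derivable1_diffP/differentiable_continuous. Qed.

(** * Continuity and two derivatives of the Perron root *)

Section PerronRootSmooth.
Variables (R : realType) (n : nat) (A A' : R -> 'M[R]_n.+1) (l : R -> R).
Hypothesis A_gt0 : forall t : R, 0 < t -> posmx (A t).
Hypothesis lA : forall t : R, 0 < t -> largest_real_root (char_poly (A t)) (l t).
Hypothesis dA : forall t : R, 0 < t ->
  forall i j, is_derive t 1 (fun s => A s i j) (A' t i j).
Hypothesis dA' : forall t : R, 0 < t ->
  forall i j, derivable (fun s => A' s i j) t 1.

Let derA (t : R) : 0 < t -> forall i j, derivable (fun s => A s i j) t 1.
Proof. by move=> t0 i j; have [] := dA t0 i j. Qed.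

Let contA (s : R) i j : 0 < s -> {for s, continuous (fun t => A t i j)}.
Proof. by move=> s0; apply: derivable_continuous; exact: derA. Qed.

Lemma continuous_perron_root (s : R) : 0 < s -> {for s, continuous l}.
Proof.
move=> s0; have [K KP] := perron_root_lipschitz (A_gt0 s0) (lA s0).
pose S t := K * \sum_i \sum_j `|A t i j - A s i j|.
have S0 : S t @[t --> s] --> (0 : R).
  have -> : 0 = S s.
    rewrite /S big1 ?mulr0// => i _; rewrite big1// => j _.
    by rewrite subrr normr0.
  apply: cvgM; first exact: cvg_cst.
  apply: continuous_sum => i; apply: continuous_sum => j.
  apply: cvg_norm; apply: cvgB; last exact: cvg_cst.
  exact: contA.
have near_le : \forall t \near s, l s - S t <= l t <= l s + S t.
  near=> t; rewrite -ler_distl; apply: KP; last apply: lA.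
    by apply: A_gt0; near: t; exact: lt_nbhsr.
  by near: t; exact: lt_nbhsr.
apply: (squeeze_cvgr near_le).
  have : l s - S t @[t --> s] --> l s - 0 by apply: cvgB => //; exact: cvg_cst.
  by rewrite subr0.
have : l s + S t @[t --> s] --> l s + 0 by apply: cvgD => //; exact: cvg_cst.
by rewrite addr0.
Unshelve. all: by end_near. Qed.

Let adjA t := \adj ((l t)%:M - A t).

(* Row 0 and column 0 of the adjugate are left and right Perron vectors. *)
Definition perron_root' t :=
  (\sum_i \sum_j adjA t 0 i * A' t i j * adjA t j 0) /
  (\sum_k adjA t 0 k * adjA t k 0).

Let dot_neq0 (s t : R) : 0 < s -> 0 < t -> \sum_k adjA s 0 k * adjA t k 0 != 0.
Proof.
move=> s0 t0; have [us _ _ _] := perron_adj (A_gt0 s0) (lA s0).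
have [_ vt _ _] := perron_adj (A_gt0 t0) (lA t0).
have := definite_mul_neq0 us vt; rewrite mxE.
by under eq_bigr do rewrite mxE [X in _ * X]mxE.
Qed.

(* Pairing the left eigenvector at s with the right eigenvector at t. *)
Let root_diff (s t : R) : 0 < s -> 0 < t ->
  l t = l s + \sum_i \sum_j adjA s 0 i * ((A t i j - A s i j) *
           (adjA t j 0 / \sum_k adjA s 0 k * adjA t k 0)).
Proof.
move=> s0 t0; have [_ _ us _] := perron_adj (A_gt0 s0) (lA s0).
have [_ _ _ vt] := perron_adj (A_gt0 t0) (lA t0).
have d0 := dot_neq0 s0 t0.
apply/eqP; rewrite addrC -subr_eq; apply/eqP.
apply: (mulIf d0).
rewrite -/(adjA s) in us; rewrite -/(adjA t) in vt.
pose u := row 0 (adjA s); pose v := col 0 (adjA t).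
have uv : (u *m v) 0 0 = \sum_k adjA s 0 k * adjA t k 0.
  by rewrite mxE; apply: eq_bigr => k _; rewrite !mxE.
transitivity ((u *m (A t - A s) *m v) 0 0).
  rewrite mulmxBr mulmxBl -mulmxA vt us -scalemxAr -scalemxAl -uv.
  by rewrite [RHS]mxE [X in _ = _ + X]mxE [X in _ = X - _]mxE [X in _ - X]mxE mulrBl.
rewrite -mulmxA mxE mulr_suml; apply: eq_bigr => i _.
rewrite mxE [X in _ * X]mxE mulr_sumr mulr_suml; apply: eq_bigr => j _.
rewrite 4!mxE; set d := \sum_k _ in d0 *; set x := adjA s 0 i; set y := adjA t j 0.
by field.
Qed.

(** Each term of [root_diff] is a fixed coefficient times A(t) - A(s), which is differentiable and
    vanishes at s, times a factor continuous at s. *)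
Lemma is_derive_perron_root (s : R) : 0 < s -> is_derive s 1 l (perron_root' s).
Proof.
move=> s0; pose b j t := adjA t j 0 / \sum_k adjA s 0 k * adjA t k 0.
pose a i j t := A t i j - A s i j.
have cadj i j : {for s, continuous (fun t => adjA t i j)}.
  apply: continuous_adj => k m.
  have -> : (fun t => ((l t)%:M - A t) k m) = (fun t => l t *+ (k == m) - A t k m).
    by apply/funext => t; rewrite !mxE.
  apply: cvgB; last exact: contA.
  by apply: cvgMn; exact: continuous_perron_root.
have cb j : {for s, continuous (b j)}.
  apply: cvgM; first exact: cadj.
  apply: cvgV; first exact: dot_neq0.
  apply: continuous_sum => k; apply: cvgM; [exact: cvg_cst|exact: cadj].
(* [root_diff] is available for positive t, hence on a neighbourhood of s. *)
apply: (@near_eq_is_derive _ _ _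
  (cst (l s) + \sum_i \sum_j (adjA s 0 i \*: (fun t => a i j t * b j t)))).
  near=> t; rewrite (@root_diff s t)//; last by near: t; exact: lt_nbhsr.
  rewrite /= !fctE; congr (_ + _); rewrite fct_sumE; apply: eq_bigr => i _.
  by rewrite fct_sumE.
have -> : perron_root' s =
    0 + \sum_i \sum_j (adjA s 0 i *: (A' s i j * b j s)).
  rewrite add0r /perron_root' mulr_suml; apply: eq_bigr => i _.
  by rewrite mulr_suml; apply: eq_bigr => j _; rewrite -!mulrA.
apply: is_deriveD; apply: is_derive_sum => i; apply: is_derive_sum => j.
apply: is_deriveZ; apply: is_derive_mul_continuous.
- rewrite -[A' s i j]subr0; apply: is_deriveB; exact: dA.
- by rewrite /a subrr.
- exact: cb.
Unshelve. all: by end_near. Qed.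

(** Differentiability of [l] now passes to the entries of the adjugate, and the formula is rational
    in these and in [A'], with nonzero denominator. *)
Lemma derivable_perron_root' (s : R) : 0 < s -> derivable perron_root' s 1.
Proof.
move=> s0.
have dadj i j : derivable (fun t => adjA t i j) s 1.
  apply: derivable_adj => k m.
  have -> : (fun t => ((l t)%:M - A t) k m) = (fun t => l t *+ (k == m) - A t k m).
    by apply/funext => t; rewrite !mxE.
  apply: derivableB; last exact: derA.
  have [dl _] := is_derive_perron_root s0.
  by case: (k == m) => //=; exact: derivable_cst.
apply: derivableM.
  apply: derivable_fsum => i _; apply: derivable_fsum => j _.
  by apply: derivableM => //; apply: derivableM => //; exact: dA'.
apply: derivableV; first exact: dot_neq0.
by apply: derivable_fsum => k _; apply: derivableM.
Qed.

End PerronRootSmooth.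

(** * Sums over cyclic chains *)

Section CyclicChain.
Variables (R : realType) (S : finType) (P : pred S) (K : S -> S -> R).
Variables (V : S -> R) (l : R).
Hypothesis K_gt0 : forall x y, 0 < K x y.
Hypothesis V_gt0 : forall x, 0 < V x.
Hypothesis KV : forall x, P x -> \sum_(y | P y) K x y * V y = l * V x.

(** The weight of an open chain: M + 1 sites, M links, no closing factor. *)
Let path_weight M (s : {ffun 'I_M.+1 -> S}) :=
  \prod_(i < M) K (s (inord i)) (s (inord i.+1)).

Let snoc M (p : {ffun 'I_M.+1 -> S} * S) : {ffun 'I_M.+2 -> S} :=
  [ffun i : 'I_M.+2 => if (i <= M)%N then p.1 (inord i) else p.2].

Let snoc_bij M : bijective (@snoc M).
Proof.
exists (fun s : {ffun 'I_M.+2 -> S} =>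
  ([ffun i : 'I_M.+1 => s (inord i)], s ord_max)).
- move=> [s y]; congr pair; last by rewrite ffunE ltnn.
  apply/ffunP => i; rewrite !ffunE inordK ?(ltnW (ltn_ord i))//.
    by rewrite -ltnS ltn_ord inord_val.
  by rewrite ltnS ltnW.
- move=> s; apply/ffunP => i; rewrite !ffunE/=; case: leqP => iM.
    by rewrite inordK// inord_val.
  by congr (s _); apply/val_inj => /=; apply/eqP; rewrite eqn_leq iM -ltnS ltn_ord.
Qed.

Let snoc_inord M (p : {ffun 'I_M.+1 -> S} * S) i :
  (i <= M)%N -> snoc p (inord i) = p.1 (inord i).
Proof. by move=> iM; rewrite ffunE inordK ?iM// ltnS leqW. Qed.

Let snoc_max M (p : {ffun 'I_M.+1 -> S} * S) : snoc p (inord M.+1) = p.2.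
Proof. by rewrite ffunE inordK ?ltnn. Qed.

Let snoc_forall M (p : {ffun 'I_M.+1 -> S} * S) :
  [forall i, P (snoc p i)] = [forall i, P (p.1 i)] && P p.2.
Proof.
apply/forallP/andP => [Pp|[/forallP Pp1 Pp2] i].
  split; last by rewrite -(snoc_max p).
  apply/forallP => i; rewrite -(inord_val i) -snoc_inord//.
  by rewrite -ltnS.
by rewrite ffunE; case: ifP.
Qed.

(** Induction on the length: by [KV], summing out the last site turns its V into l times V of the
    site before. *)
Let path_sum M :
  \sum_(s : {ffun 'I_M.+1 -> S} | [forall i, P (s i)])
     path_weight s * V (s (inord M)) =
  l ^+ M * \sum_(s : {ffun 'I_1 -> S} | [forall i, P (s i)]) V (s ord0).
Proof.
elim: M => [|M IH].
  rewrite mul1r; apply: eq_bigr => s _; rewrite /path_weight big_ord0 mul1r.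
  by congr (V (s _)); apply/val_inj; rewrite /= inordK.
rewrite (reindex _ (onW_bij _ (snoc_bij M)))/=.
under eq_bigl do rewrite snoc_forall.
rewrite exprS -mulrA -IH mulr_sumr.
rewrite -(pair_big (fun s : {ffun 'I_M.+1 -> S} => [forall i, P (s i)]) P
  (fun s y => path_weight (snoc (s, y)) * V (snoc (s, y) (inord M.+1))))/=.
apply: eq_bigr => s /forallP Ps; rewrite mulrCA -KV// mulr_sumr.
apply: eq_bigr => y _; rewrite snoc_max mulrA; congr (_ * _).
rewrite /path_weight big_ord_recr/= snoc_max snoc_inord//; congr (_ * _).
by apply: eq_bigr => i _; rewrite !snoc_inord// ltnW.
Qed.

(* Replacing the closing factor of a cycle by V of the last site changes the
   weight by at most a bounded factor, and open chains are summed exactly. *)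
Lemma cyclic_sum_bounds : (exists x, P x) -> 0 < l ->
  exists c C, [/\ 0 < c, 0 < C & forall M, c * l ^+ M.+1 <=
    \sum_(s : {ffun 'I_M.+1 -> S} | [forall i, P (s i)])
      \prod_(m < M.+1) K (s m) (s (next_layer m)) <= C * l ^+ M.+1].
Proof.
move=> [x0 Px0] l0.
(* K(x, y) / V(x) lies between c and 1/d uniformly, which compares the closing factor with V at the
   last site. *)
have [c c0 cK] := @exists_gt0_lower_bound R (S * S)%type
  (fun p => K p.1 p.2 / V p.1) (fun p => divr_gt0 (K_gt0 _ _) (V_gt0 _)).
have [d d0 dK] := @exists_gt0_lower_bound R (S * S)%type
  (fun p => V p.1 / K p.1 p.2) (fun p => divr_gt0 (V_gt0 _) (K_gt0 _ _)).
set V0 := \sum_(s : {ffun 'I_1 -> S} | [forall i, P (s i)]) V (s ord0).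
have V00 : 0 < V0.
  rewrite /V0 (bigD1 [ffun=> x0])/=; last by apply/forallP => i; rewrite ffunE.
  by rewrite ltr_pwDl// sumr_ge0// => i _; rewrite ltW.
(* A cycle of M + 1 sites opens to a chain of M links, whose sum is l^M V0; the division by l makes
   up for the exponent M + 1. *)
exists (c * V0 / l), (d^-1 * V0 / l); split.
- by rewrite divr_gt0// mulr_gt0.
- by rewrite divr_gt0// mulr_gt0// invr_gt0.
move=> M.
have cyc (s : {ffun 'I_M.+1 -> S}) :
    \prod_(m < M.+1) K (s m) (s (next_layer m)) =
    path_weight s * K (s (inord M)) (s (inord 0)).
  rewrite big_ord_recr/=; congr (_ * _).
    apply: eq_bigr => i _; congr (K (s _) (s _)); apply/val_inj => /=.
      by rewrite inordK// ltnS ltnW.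
    by rewrite inordK ?modn_small ?ltnS.
  by congr (K (s _) (s _)); apply/val_inj => /=; rewrite inordK// modnn.
have pw (s : {ffun 'I_M.+1 -> S}) : 0 <= path_weight s.
  by apply: prodr_ge0 => i _; rewrite ltW.
have bnd (e : R) : e * V0 / l * l ^+ M.+1 =
    \sum_(s : {ffun 'I_M.+1 -> S} | [forall i, P (s i)])
     e * (path_weight s * V (s (inord M))).
  rewrite -mulr_sumr path_sum -/V0 exprS.
  by rewrite mulrA divfK ?gt_eqF// -mulrA [V0 * _]mulrC.
rewrite !bnd; apply/andP; split; apply: ler_sum => s _; rewrite cyc mulrCA ler_wpM2l//.
  by rewrite -ler_pdivlMr//; exact: (cK (_, _)).
by rewrite mulrC ler_pdivlMr// mulrC -ler_pdivlMr//; exact: (dK (_, _)).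
Qed.

End CyclicChain.

(** Logarithms squeeze the sequence between ln l + ln c / (M + 1) and ln l + ln C / (M + 1); the
    index shift skips M = 0. *)
Lemma cvg_ln_geometric (R : realType) (z : nat -> R) (l c C : R) :
  0 < l -> 0 < c -> 0 < C ->
  (forall M, c * l ^+ M.+1 <= z M.+1 <= C * l ^+ M.+1) ->
  ln (z M) / M%:R @[M --> \oo] --> ln l.
Proof.
move=> l0 c0 C0 zl; rewrite -cvg_shiftS.
have cvgh (e : R) : ln l + ln e * harmonic M @[M --> \oo] --> ln l.
  have : ln l + ln e * harmonic M @[M --> \oo] --> ln l + ln e * 0.
    apply: cvgD; first exact: cvg_cst.
    by apply: cvgM; [exact: cvg_cst|exact: cvg_harmonic].
  by rewrite mulr0 addr0.
apply: (squeeze_cvgr _ (cvgh c) (cvgh C)); apply: nearW => M /=.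
have lnE (e : R) : 0 < e -> ln l + ln e / M.+1%:R = ln (e * l ^+ M.+1) / M.+1%:R.
  move=> e0; rewrite lnM ?posrE ?exprn_gt0// lnXn// -[ln l *+ _]mulr_natr.
  by rewrite mulrDl mulfK ?pnatr_eq0// addrC.
have /andP[lo hi] := zl M.
have lM e : 0 < e -> 0 < e * l ^+ M.+1 by move=> e0; rewrite mulr_gt0// exprn_gt0.
have z0 : 0 < z M.+1 by apply: lt_le_trans lo; exact: lM.
by rewrite !lnE// !ler_pM2r ?invr_gt0 ?ltr0n// !ler_ln ?posrE ?lM// lo hi.
Qed.

(** * Lumping of the layer states *)

Definition layer := {ffun 'I_4 -> bool}.

(** [true] stands for spin +1 while a set bit of k - 1 stands for spin -1, hence the negation. *)
Definition layer_of (k : nat) : layer := [ffun i : 'I_4 => ~~ odd (k.-1 %/ 2 ^ i)].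

Definition index_of (a : layer) : nat :=
  (1 + ~~ a (inord 0) + 2 * ~~ a (inord 1) + 4 * ~~ a (inord 2)
     + 8 * ~~ a (inord 3))%N.

Definition layer_weight (R : realType) (kB J1 J2 J3 T : R) (a b : layer) : R :=
  expR (- cube_energy J1 J2 J3 (fun i => spin R (a i)) (fun i => spin R (b i))
        / (kB * T)).

Lemma ord4P (P : 'I_4 -> Prop) :
  P (inord 0) -> P (inord 1) -> P (inord 2) -> P (inord 3) -> forall i, P i.
Proof.
by move=> P0 P1 P2 P3 i; rewrite -(inord_val i); case: i => -[|[|[|[|]]]].
Qed.

Lemma index_ofK a : layer_of (index_of a) = a.
Proof.
apply/ffunP; apply: ord4P; rewrite ffunE !inordK// /index_of;
by case: (a _); case: (a _); case: (a _); case: (a _).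
Qed.

Lemma layer_ofK : all (fun k => index_of (layer_of k) == k) (iota 1 16).
Proof. by rewrite /= /index_of !ffunE !inordK. Qed.

Lemma index_of_mem a : index_of a \in iota 1 16.
Proof.
by rewrite /index_of; case: (a _); case: (a _); case: (a _); case: (a _).
Qed.

Lemma perm_layers : perm_eq (index_enum layer) (map layer_of (iota 1 16)).
Proof.
apply: uniq_perm; first exact: index_enum_uniq.
  apply: (@map_uniq _ _ index_of); rewrite -map_comp map_id_in ?iota_uniq//.
  by move=> k /(allP layer_ofK)/eqP.
move=> a; rewrite mem_index_enum; apply/esym/mapP.
by exists (index_of a); [exact: index_of_mem|rewrite index_ofK].
Qed.

Lemma state_layer (R : realType) k :
  @state R k = fun i => spin R (layer_of k i).
Proof. by apply/funext => i; rewrite /state ffunE /spin if_neg. Qed.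

Lemma theta_layer (R : realType) (kB J1 J2 J3 T : R) k l :
  theta kB J1 J2 J3 T k l =
  layer_weight kB J1 J2 J3 T (layer_of k) (layer_of l).
Proof. by rewrite /theta !state_layer. Qed.

(** Integer spins let energies be compared by evaluation, for all real couplings at once. *)
Definition zspin (k i : nat) : int := if odd (k.-1 %/ 2 ^ i) then -1 else 1.

(* The integers multiplying J1 / 2, J2 / 4 and J3 / 8 in minus the energy. *)
Definition couplings (k l : nat) : int * int * int :=
  let a := zspin k in let b := zspin l in
  let sum4 (f : nat -> int) := f 0%N + f 1%N + f 2%N + f 3%N in
  let prod4 (f : nat -> int) := f 0%N * f 1%N * f 2%N * f 3%N in
  let p r := ((r + 1) %% 4)%N in
  let q r := ((r + 2) %% 4)%N in
  let m r := ((r + 3) %% 4)%N in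
  (sum4 (fun r => a r * a (p r) + b r * b (p r) + 2 * (a r * b r)),
   sum4 (fun r => a r * a (q r) + b r * b (q r) + 4 * (a r * b (p r))
                  + 4 * (a r * b (m r))),
   4 * prod4 a + 4 * prod4 b
     + 8 * sum4 (fun r => a r * a (p r) * b r * b (p r))).

Definition coupling_weight (R : realType) (kB J1 J2 J3 T : R)
    (e : int * int * int) : R :=
  expR ((J1 * (e.1.1%:~R / 2) + J2 * (e.1.2%:~R / 4) + J3 * (e.2%:~R / 8))
        / (kB * T)).

Lemma thetaE (R : realType) (kB J1 J2 J3 T : R) k l :
  theta kB J1 J2 J3 T k l = coupling_weight kB J1 J2 J3 T (couplings k l).
Proof.
suff energyE : - cube_energy J1 J2 J3 (state R k) (state R l) =
    J1 * ((couplings k l).1.1%:~R / 2) + J2 * ((couplings k l).1.2%:~R / 4)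
      + J3 * ((couplings k l).2%:~R / 8).
  by rewrite /theta energyE.
rewrite /cube_energy opprK.
have stE j (i : 'I_4) : @state R j i = (zspin j i)%:~R.
  by rewrite /state /zspin; case: ifP.
have stS j (i : 'I_4) n : @state R j (shift4 i n) = (zspin j ((i + n) %% 4))%:~R.
  by rewrite stE inordK// ltn_mod.
rewrite !big_ord_recl !big_ord0 !stS !stE.
rewrite /couplings /= /bump /=.
set a := zspin k; set b := zspin l.
rewrite !add1n /modn /=.
by field.
Qed.

Section Lumping.
Variables (R : realType) (kB J1 J2 J3 T : R) (n : nat).
Variables (gs : seq (seq nat)) (rs : seq nat).

Definition lumped_matrix : 'M[R]_n.+1 :=
  \matrix_(i < n.+1, j < n.+1)
    \sum_(l <- nth [::] gs j) theta kB J1 J2 J3 T (nth 0%N rs i) l.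

(** An index outside every group gets the value [size gs]. *)
Definition group_of (k : nat) := find (fun g : seq nat => k \in g) gs.

(** A decidable form of strong lumpability: nonempty groups partition the admissible indices, and
    each state has the same multiset of couplings into any group as the representative of its own
    group. Comparing multisets rather than sums covers all parameters. *)
Definition lumpable (P : pred nat) : bool :=
  [&& size gs == n.+1, all (fun g => g != [::]) gs,
      perm_eq (flatten gs) (seq.filter P (iota 1 16)),
      all (fun j => all (fun l => group_of l == j) (nth [::] gs j)) (iota 0 n.+1)
    & all (fun k => all (fun g => perm_eq (map (couplings k) g)
                          (map (couplings (nth 0%N rs (group_of k))) g)) gs)
        (flatten gs)].

(** The lift of [w] is constant on groups, so the kernel sum splits into group sums of weights, and
    by lumpability these are the entries in the row of the representative. *)
Lemma lumped_eigenvector (P : pred nat) (w : 'cV[R]_n.+1) (x : R) (a : layer) :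
  lumpable P -> lumped_matrix *m w = x *: w -> P (index_of a) ->
  \sum_(b | P (index_of b)) layer_weight kB J1 J2 J3 T a b
      * w (inord (group_of (index_of b))) 0
  = x * w (inord (group_of (index_of a))) 0.
Proof.
move=> /and5P[/eqP sz _ perm_gs /allP grp /allP row] wx Pa.
have ka : index_of a \in flatten gs.
  by rewrite (perm_mem perm_gs) mem_filter Pa index_of_mem.
set k := index_of a in ka *.
have gk : (group_of k < n.+1)%N.
  by rewrite -sz -has_find; move/flattenP: ka => [g gg kg]; apply/hasP; exists g.
have -> : x * w (inord (group_of k)) 0 = (lumped_matrix *m w) (inord (group_of k)) 0.
  by rewrite wx mxE.
rewrite (perm_big _ perm_layers) big_map.
transitivity (\sum_(l <- flatten gs)
    theta kB J1 J2 J3 T k l * w (inord (group_of l)) 0).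
  rewrite (perm_big _ perm_gs) big_filter.
  rewrite [LHS]big_seq_cond [RHS]big_seq_cond.
  apply: eq_big => [l|l /andP[lI _]].
    by case: (boolP (l \in _)) => //= /(allP layer_ofK)/eqP ->.
  by rewrite theta_layer index_ofK (eqP (allP layer_ofK _ lI)).
rewrite big_flatten/= (big_nth [::]) sz big_mkord mxE.
apply: eq_bigr => j _; rewrite mxE inordK// mulr_suml.
have jI : (j : nat) \in iota 0 n.+1 by rewrite mem_iota ltn_ord.
have jg : nth [::] gs j \in gs by rewrite mem_nth// sz.
rewrite big_seq [RHS](_ : _ = \sum_(l <- nth [::] gs j)
    theta kB J1 J2 J3 T k l * w j 0).
  rewrite [RHS]big_seq; apply: eq_bigr => l lj.
  by rewrite (eqP (allP (grp _ jI) _ lj)) inord_val.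
rewrite -!mulr_suml; congr (_ * _).
under eq_bigr do rewrite thetaE.
under [RHS]eq_bigr do rewrite thetaE.
have := allP (row _ ka) _ jg => /(perm_big _)/= pb.
rewrite -(big_map (couplings k) predT (coupling_weight kB J1 J2 J3 T)).
by rewrite -(big_map (couplings _) predT (coupling_weight kB J1 J2 J3 T)) pb.
Qed.

End Lumping.

Definition nonperc_index (k : nat) : bool :=
  all (fun r => ~~ (odd (k.-1 %/ 2 ^ r) && odd (k.-1 %/ 2 ^ ((r + 1) %% 4))))
    (iota 0 4).

Lemma nonperc_indexE (a : layer) :
  [forall r : 'I_4, ~~ (~~ a r && ~~ a (shift4 r 1))] =
  nonperc_index (index_of a).
Proof.
rewrite -[in LHS](index_ofK a).
under eq_forallb => r do rewrite !ffunE !negbK inordK ?ltn_mod//.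
apply/forallP/allP => [H r|H r].
  by rewrite mem_iota => /andP[_ r4]; have := H (Ordinal r4).
by apply: H; rewrite mem_iota ltn_ord.
Qed.

(** The groups are the orbits of layers under rotation and global spin flip, which preserve the cube
    energy when applied to both layers. *)
Lemma lumpable_tau : lumpable 3 groups reps predT.
Proof. by vm_compute. Qed.

(** Here the groups are orbits under rotation alone, as a flip can leave the admissible layers. *)
Lemma lumpable_tau' : lumpable 2 groups' reps' nonperc_index.
Proof. by vm_compute. Qed.

(** * Partition functions and their exponential growth rates *)

Lemma boltzmann_prod (R : realType) (kB J1 J2 J3 T : R) M (s : config M) :
  expR (- energy J1 J2 J3 s / (kB * T)) =
  \prod_(m < M) layer_weight kB J1 J2 J3 T (s m) (s (next_layer m)).
Proof. by rewrite /energy -sumrN mulr_suml expR_sum. Qed.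

Section LumpedLimit.
Variables (R : realType) (kB J1 J2 J3 T : R) (n : nat).
Variables (gs : seq (seq nat)) (rs : seq nat) (P : pred nat) (x : R).
Hypothesis lump : lumpable n gs rs P.
Hypothesis xP :
  largest_real_root (char_poly (lumped_matrix kB J1 J2 J3 T n gs rs)) x.

Lemma posmx_lumped (t : R) : posmx (lumped_matrix kB J1 J2 J3 t n gs rs).
Proof.
move=> i j; rewrite mxE; move: lump => /and5P[/eqP sz /allP gs0 _ _ _].
have /gs0 : nth [::] gs j \in gs by rewrite mem_nth// sz.
case: (nth [::] gs j) => // l g _; rewrite big_cons ltr_pwDl ?expR_gt0//.
by apply: sumr_ge0 => k _; exact: expR_ge0.
Qed.

Let exists_index : exists a : layer, P (index_of a).
Proof.
move: lump => /and5P[/eqP sz /allP gs0 perm_gs _ _].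
have g0 : nth [::] gs 0 \in gs by rewrite mem_nth// sz.
have := gs0 _ g0; case: (nth [::] gs 0) g0 => // k g gin _.
have : k \in flatten gs by apply/flattenP; exists (k :: g); rewrite ?mem_head.
rewrite (perm_mem perm_gs) mem_filter => /andP[Pk kI].
by exists (layer_of k); rewrite (eqP (allP layer_ofK _ kI)).
Qed.

Lemma lumped_root_gt0 : 0 < x.
Proof.
by have [v [w [x0 _ _ _ _]]] := largest_real_root_perron (@posmx_lumped T) xP.
Qed.

(** Equal to [Z] when P is [predT] and to [Z'] when P is [nonperc_index]. *)
Let restricted_sum (M : nat) : R :=
  \sum_(s : config M | [forall m, P (index_of (s m))])
    expR (- energy J1 J2 J3 s / (kB * T)).

(** The right Perron vector, lifted to layers, serves as the function V of [cyclic_sum_bounds]. *)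
Let restricted_sum_bounds : exists c C, [/\ 0 < c, 0 < C & forall M,
  c * x ^+ M.+1 <= restricted_sum M.+1 <= C * x ^+ M.+1].
Proof.
have [v [w [x0 _ w0 _ Aw]]] := largest_real_root_perron (@posmx_lumped T) xP.
have [c [C [c0 C0 H]]] := @cyclic_sum_bounds R layer (fun a => P (index_of a))
  (layer_weight kB J1 J2 J3 T) (fun a => w (inord (group_of gs (index_of a))) 0) x
  (fun _ _ => expR_gt0 _) (fun _ => w0 _ _)
  (fun a => lumped_eigenvector lump Aw) exists_index x0.
exists c, C; split=> // M; rewrite /restricted_sum.
by under eq_bigr do rewrite boltzmann_prod.
Qed.

Lemma restricted_sum_gt0 M : 0 < restricted_sum M.+1.
Proof.
have [c [C [c0 _ /(_ M)/andP[+ _]]]] := restricted_sum_bounds.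
by apply: lt_le_trans; rewrite mulr_gt0// exprn_gt0// lumped_root_gt0.
Qed.

Lemma cvg_ln_restricted_sum :
  ln (restricted_sum M) / M%:R @[M --> \oo] --> ln x.
Proof.
have [c [C [c0 C0 H]]] := restricted_sum_bounds.
exact: cvg_ln_geometric lumped_root_gt0 c0 C0 H.
Qed.

End LumpedLimit.

(** * Temperature derivatives of the transfer weights and of [tau] *)

Lemma is_derive_fsum (R : realType) (I : Type) (r : seq I)
    (f : I -> R -> R) (df : I -> R) (s : R) :
  (forall i, is_derive s 1 (f i) (df i)) ->
  is_derive s 1 (fun t => \sum_(i <- r) f i t) (\sum_(i <- r) df i).
Proof.
move=> Hf; elim: r => [|i r IH].
  under eq_fun do rewrite big_nil.
  by rewrite big_nil; exact: is_derive_cst.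
under eq_fun do rewrite big_cons.
by rewrite big_cons; exact: is_deriveD (Hf i) IH.
Qed.

Section TauDerivative.
Variables (R : realType) (kB J1 J2 J3 : R).
Hypothesis kB_gt0 : 0 < kB.

Definition dtheta (t : R) (k l : nat) : R :=
  theta kB J1 J2 J3 t k l *
  (- cube_energy J1 J2 J3 (state R k) (state R l) * (- (kB * t) ^- 2 * kB)).

Lemma is_derive_theta (t : R) k l : 0 < t ->
  is_derive t 1 (fun s => theta kB J1 J2 J3 s k l) (dtheta t k l).
Proof.
move=> t0; set c := - cube_energy J1 J2 J3 (state R k) (state R l).
have kt : kB * t != 0 by rewrite mulf_neq0// gt_eqF.
have dk : is_derive t 1 (fun s : R => kB * s) kB.
  rewrite -[X in is_derive _ _ _ X]mulr1.
  exact: (@is_deriveZ _ _ _ id).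
have dV : is_derive t 1 (fun s : R => (kB * s)^-1) (- (kB * t) ^- 2 * kB).
  exact: (@is_deriveV _ (fun s : R => kB * s)).
have dc : is_derive t 1 (fun s : R => c / (kB * s)) (c * (- (kB * t) ^- 2 * kB)).
  exact: (@is_deriveZ _ _ _ (fun s : R => (kB * s)^-1)).
exact: (@is_derive1_comp _ expR (fun s : R => c / (kB * s))).
Qed.

Lemma derivable_dtheta (t : R) k l : 0 < t ->
  derivable (fun s => dtheta s k l) t 1.
Proof.
move=> t0; have kt : kB * t != 0 by rewrite mulf_neq0// gt_eqF.
have dth : derivable (fun s => theta kB J1 J2 J3 s k l) t 1.
  by have [] := is_derive_theta k l t0.
have dk : derivable (fun s : R => kB * s) t 1.
  by apply: derivableM; [exact: derivable_cst|exact: derivable_id].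
have dV : derivable (fun s : R => - (kB * s) ^- 2) t 1.
  apply: derivableN; apply: (@derivableV _ _ (fun s : R => (kB * s) ^+ 2)).
    by rewrite expf_neq0.
  exact: (derivableM dk dk).
have dVk : derivable (fun s : R => - (kB * s) ^- 2 * kB) t 1.
  exact: (derivableM dV (derivable_cst _ _ _)).
pose c := - cube_energy J1 J2 J3 (state R k) (state R l).
have dc : derivable (fun s : R => c * (- (kB * s) ^- 2 * kB)) t 1.
  exact: (derivableM (derivable_cst _ _ _) dVk).
exact: (derivableM dth dc).
Qed.

Definition dtau (t : R) : 'M[R]_4 :=
  \matrix_(i < 4, j < 4)
    \sum_(l <- nth [::] groups j) dtheta t (nth 0%N reps i) l.

Lemma is_derive_tau (t : R) i j : 0 < t ->
  is_derive t 1 (fun s => tau kB J1 J2 J3 s i j) (dtau t i j).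
Proof.
move=> t0; rewrite mxE.
have -> : (fun s => tau kB J1 J2 J3 s i j) = (fun s =>
    \sum_(l <- nth [::] groups j) theta kB J1 J2 J3 s (nth 0%N reps i) l).
  by apply/funext => s; rewrite mxE.
by apply: is_derive_fsum => l; exact: is_derive_theta.
Qed.

Lemma derivable_dtau (t : R) i j : 0 < t -> derivable (fun s => dtau s i j) t 1.
Proof.
move=> t0; have -> : (fun s => dtau s i j) = (fun s =>
    \sum_(l <- nth [::] groups j) dtheta s (nth 0%N reps i) l).
  by apply/funext => s; rewrite mxE.
by apply: derivable_fsum => l _; exact: derivable_dtheta.
Qed.

End TauDerivative.

(** * Free energy, its temperature derivatives and the non-percolation rate *)

Unset Implicit Arguments.

Theorem theorem5 (R : realType) (kB J1 J2 J3 : R) (lam mu : R -> R) :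
  0 < kB ->
  (forall T, 0 < T -> largest_real_root (char_poly (tau kB J1 J2 J3 T)) (lam T)) ->
  (forall T, 0 < T -> largest_real_root (char_poly (tau' kB J1 J2 J3 T)) (mu T)) ->
  forall T, 0 < T ->
  let g := fun t => ln (lam t) / 4 in
  [/\ (fun M : nat => ln (Z kB J1 J2 J3 M T) / (4 * M%:R)) @ \oo --> g T,
      free_energy kB J1 J2 J3 T = - (kB * T / 4) * ln (lam T),
      derivable (fun t => free_energy kB J1 J2 J3 t / t) T 1
        /\ derivable g T 1
        /\ internal_energy kB J1 J2 J3 T = kB * T ^+ 2 * derive1 g T,
      derivable (internal_energy kB J1 J2 J3) T 1
        /\ derivable (derive1 g) T 1
        /\ heat_capacity kB J1 J2 J3 T
             = 2 * kB * T * derive1 g T + kB * T ^+ 2 * derive1 (derive1 g) T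
    & (fun M : nat => ln (Z' kB J1 J2 J3 M T / Z kB J1 J2 J3 M T) / M%:R) @ \oo
        --> ln (mu T / lam T)].
Proof.
move=> kB0 lamP muP T T0 g.
have allT M : (fun s : config M => [forall m, predT (index_of (s m))]) =1 predT.
  by move=> s; apply/forallP.
have ZE M t : Z kB J1 J2 J3 M t =
    \sum_(s : config M | [forall m, predT (index_of (s m))])
      expR (- energy J1 J2 J3 s / (kB * t)).
  by rewrite (eq_bigl _ _ (allT M)).
have Z'E M t : Z' kB J1 J2 J3 M t =
    \sum_(s : config M | [forall m, nonperc_index (index_of (s m))])
      expR (- energy J1 J2 J3 s / (kB * t)).
  by apply: eq_bigl => s; apply: eq_forallb => m; exact: nonperc_indexE.
have lam_gt0 (t : R) : 0 < t -> 0 < lam t.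
  by move=> t0; exact: (lumped_root_gt0 lumpable_tau (lamP t t0)).
have mu_gt0 (t : R) : 0 < t -> 0 < mu t.
  by move=> t0; exact: (lumped_root_gt0 lumpable_tau' (muP t t0)).
have cvgZ (t : R) : 0 < t ->
    ln (Z kB J1 J2 J3 M t) / M%:R @[M --> \oo] --> ln (lam t).
  move=> t0; under eq_fun do rewrite ZE.
  exact: cvg_ln_restricted_sum lumpable_tau (lamP t t0).
have cvgZ' (t : R) : 0 < t ->
    ln (Z' kB J1 J2 J3 M t) / M%:R @[M --> \oo] --> ln (mu t).
  move=> t0; under eq_fun do rewrite Z'E.
  exact: cvg_ln_restricted_sum lumpable_tau' (muP t t0).
have cvg4 (t : R) : 0 < t ->
    (fun M : nat => ln (Z kB J1 J2 J3 M t) / (4 * M%:R)) @ \oo --> g t.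
  move=> t0; under eq_fun do rewrite invfM mulrCA mulrC.
  by apply: cvgM; [exact: cvgZ|exact: cvg_cst].
have feE (t : R) : 0 < t -> free_energy kB J1 J2 J3 t = - kB * t * g t.
  by move=> t0; congr (_ * _); apply: cvg_lim => //; exact: cvg4.
pose dl := perron_root' (tau kB J1 J2 J3) (dtau kB J1 J2 J3) lam.
have dlam (t : R) : 0 < t -> is_derive t 1 lam (dl t).
  apply: is_derive_perron_root => //.
  - by move=> s s0; exact: posmx_lumped lumpable_tau s.
  - by move=> s s0 i j; exact: is_derive_tau.
have ddl (t : R) : 0 < t -> derivable dl t 1.
  apply: derivable_perron_root' => //.
  - by move=> s s0; exact: posmx_lumped lumpable_tau s.
  - by move=> s s0 i j; exact: is_derive_tau.
  - by move=> s s0 i j; exact: derivable_dtau.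
(* The logarithmic derivative of [lam], divided by 4. *)
pose dg t := (lam t)^-1 * dl t * 4^-1.
have gP (t : R) : 0 < t -> is_derive t 1 g (dg t).
  move=> t0.
  have dln : is_derive t 1 (@ln R \o lam) ((lam t)^-1 * dl t).
    by apply: is_derive1_comp; [exact: is_derive1_ln (lam_gt0 t t0)|exact: dlam].
  have -> : g = 4^-1 \*: (@ln R \o lam) by apply/funext => s; rewrite /g mulrC.
  by rewrite /dg mulrC; exact: is_deriveZ.
have dgP : derivable dg T 1.
  have dlamV : derivable (fun t => (lam t)^-1) T 1.
    apply: derivableV; first by rewrite gt_eqF ?lam_gt0.
    by have [] := dlam T T0.
  exact: (derivableM (derivableM dlamV (ddl T T0)) (derivable_cst _ _ _)).
have derive1_val (f : R -> R) (t df : R) : is_derive t 1 f df -> derive1 f t = df.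
  by move=> [_ <-]; rewrite derive1E.
have nearT : \forall t \near T, 0 < t by exact: lt_nbhsr.
(* The formula for g' holds at positive temperatures, so differentiability passes from [dg] to
   [derive1 g] through equality near T. *)
have near_dg : \forall t \near T, dg t = derive1 g t.
  by near=> t; apply/esym/derive1_val/gP; near: t.
have ddgP : is_derive T 1 (derive1 g) (derive1 (derive1 g) T).
  have dd : derivable (derive1 g) T 1 by exact: near_eq_derivable dgP.
  by apply: DeriveDef; [exact: dd|rewrite derive1E].
have feP (t : R) : 0 < t ->
    is_derive t 1 (fun t => free_energy kB J1 J2 J3 t / t) (- kB * dg t).
  (* At positive temperatures the prefactor of the free energy cancels the division, leaving - kB
     g. *)
  move=> t0; apply: (@near_eq_is_derive _ _ _ ((- kB) \*: g)).
    near=> s; have s0 : 0 < s by near: s; exact: lt_nbhsr.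
    by rewrite feE// mulrAC mulfK ?gt_eqF.
  by apply: is_deriveZ; exact: gP.
have ieE (t : R) : 0 < t -> internal_energy kB J1 J2 J3 t = kB * t ^+ 2 * dg t.
  move=> t0; rewrite /internal_energy (derive1_val _ _ _ (feP t t0)).
  by rewrite !mulNr mulrN opprK mulrA [_ * kB]mulrC.
have ieP : is_derive T 1 (internal_energy kB J1 J2 J3)
    (2 * kB * T * derive1 g T + kB * T ^+ 2 * derive1 (derive1 g) T).
  pose h (t : R) : R := kB * t ^+ 2 * derive1 g t.
  apply: (@near_eq_is_derive _ _ _ h).
    near=> t; have t0 : 0 < t by near: t.
    by rewrite /h ieE// (derive1_val _ _ _ (gP t t0)).
  have d2 : is_derive T 1 (fun t : R => kB * t ^+ 2) (2 * kB * T).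
    have dT : is_derive T 1 (fun t : R => t * t) (T + T).
      by have := is_deriveM (is_derive_id T 1) (is_derive_id T 1);
        rewrite /GRing.scale/= !mulr1.
    rewrite (_ : 2 * kB * T = kB * (T + T)); last by ring.
    exact: is_deriveZ.
  rewrite (_ : _ + _ = (kB * T ^+ 2) *: derive1 (derive1 g) T
    + derive1 g T *: (2 * kB * T)); last by rewrite addrC; congr (_ + _); rewrite mulrC.
  exact: (is_deriveM d2 ddgP).
split.
- exact: cvg4.
- by rewrite feE// /g; ring.
- split; first by have [] := feP T T0.
  split; first by have [] := gP T T0.
  by rewrite ieE// (derive1_val _ _ _ (gP T T0)).
- split; first by have [] := ieP.
  split; first by have [] := ddgP.
  exact: derive1_val ieP.
- rewrite ln_div ?posrE ?lam_gt0 ?mu_gt0//.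
  have -> : (fun M : nat => ln (Z' kB J1 J2 J3 M T / Z kB J1 J2 J3 M T) / M%:R) =
      (fun M : nat => ln (Z' kB J1 J2 J3 M T) / M%:R
                      - ln (Z kB J1 J2 J3 M T) / M%:R).
    (* At M = 0 both sides are 0 because the inverse of 0 is 0; otherwise both sums are positive and
       the logarithm of the quotient splits. *)
    apply/funext => -[|M]; first by rewrite invr0 !mulr0 subrr.
    rewrite ln_div ?posrE ?mulrBl// ?ZE ?Z'E.
      exact: restricted_sum_gt0 lumpable_tau' (muP T T0) M.
    exact: restricted_sum_gt0 lumpable_tau (lamP T T0) M.
  by apply: cvgB; [exact: cvgZ'|exact: cvgZ].
Unshelve. all: by end_near. Qed.
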